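(* Let $n\ge0$ and let $G$ be a TDLC-group of type $\mathrm{FP}_\infty$ with $\mathrm{cd}_{\mathbb{Q}}(G)=n+1$ that satisfies the weak $n$-dimensional linear isoperimetric inequality. Then every closed subgroup $H$ of $G$ of type $\mathrm{FP}_{n+1}$ satisfies the weak $n$-dimensional linear isoperimetric inequality.
   Context: A TDLC-group is a totally disconnected locally compact Hausdorff topological group; closed subgroups of TDLC-groups are TDLC-groups. For a TDLC-group $G$: a discrete $\mathbb{Q}[G]$-module is a left $\mathbb{Q}[G]$-module in which every element has open stabilizer; they form an abelian category ${}_{\mathbb{Q}[G]}\mathrm{dis}$ with enough projectives, and $\mathrm{cd}_{\mathbb{Q}}(G)$ is the minimal length of a projective resolution of the trivial module $\mathbb{Q}$ in it. A $G$-set $\Omega$ is proper if all point stabilizers are compact open; $\mathbb{Q}[\Omega]$ is then a proper permutation module, finitely generated iff $\Omega/G$ is finite, with $\ell_1$-norm $\|\sum a_\omega\omega\|_1=\sum|a_\omega|$. $G$ has type $\mathrm{FP}_n$ if there is an exact sequence $\mathbb{Q}[\Omega_n]\to\cdots\to\mathbb{Q}[\Omega_0]\to\mathbb{Q}\to0$ in ${}_{\mathbb{Q}[G]}\mathrm{dis}$ with each $\Omega_i$ a proper $G$-set with finitely many orbits (a partial proper permutation resolution of finite type); type $\mathrm{FP}_\infty$ means type $\mathrm{FP}_n$ for all $n$. $G$ of type $\mathrm{FP}_{n+1}$ satisfies the weak $n$-dimensional linear isoperimetric inequality if for some (equivalently any) such resolution $\mathbb{Q}[\Omega_{n+1}]\xrightarrow{\delta_{n+1}}\mathbb{Q}[\Omega_n]\xrightarrow{\delta_n}\cdots\to\mathbb{Q}[\Omega_0]\to\mathbb{Q}\to0$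 there is $C>0$ with $\inf\{\|y\|_1: y\in\mathbb{Q}[\Omega_{n+1}],\ \delta_{n+1}(y)=x\}\le C\|x\|_1$ for all $x\in\ker\delta_n$. *)

(* Defs.v *)
From HB Require Import structures.
From mathcomp Require Import all_boot all_order all_algebra.
From mathcomp Require Import boolp classical_sets topology.
From mathcomp Require Import freeg.

Set Implicit Arguments.
Unset Strict Implicit.
Unset Printing Implicit Defensive.

Import Order.TTheory GRing.Theory Num.Theory.
Local Open Scope classical_set_scope.
Local Open Scope ring_scope.

Record tgroup := TGroup {
  tg_car :> topologicalType;
  tg_mul : tg_car -> tg_car -> tg_car;
  tg_inv : tg_car -> tg_car;
  tg_one : tg_car }.

Arguments tg_mul {t}.
Arguments tg_inv {t}.
Arguments tg_one {t}.

Definition group_laws (G : tgroup) : Prop :=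
  [/\ forall x y z : G, tg_mul x (tg_mul y z) = tg_mul (tg_mul x y) z,
      forall x : G, tg_mul tg_one x = x /\ tg_mul x tg_one = x &
      forall x : G, tg_mul (tg_inv x) x = tg_one /\ tg_mul x (tg_inv x) = tg_one].

Definition TDLC (G : tgroup) : Prop :=
  [/\ group_laws G,
      continuous (fun p : G * G => tg_mul p.1 p.2),
      continuous (@tg_inv G) &
      [/\ hausdorff_space G,
      locally_compact [set: G] &
      totally_disconnected [set: G]]].

Definition closed_subgroup (G : tgroup) (H : set G) : Prop :=
  [/\ closed H, H tg_one,
      forall x y, H x -> H y -> H (tg_mul x y) &
      forall x, H x -> H (tg_inv x)].

Definition open_in (G : tgroup) (H U : set G) : Prop :=
  exists V : set G, open V /\ U = V `&` H.

(* compact open subset of H (compactness in H = compactness in G) *)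
Definition compact_open_in (G : tgroup) (H K : set G) : Prop :=
  [/\ K `<=` H, compact K & open_in H K].

(* Discrete Q[H]-modules (H a closed subgroup of G; H = [set: G] gives G)  *)

Definition dmod_axioms (G : tgroup) (H : set G) (M : lmodType rat)
    (act : G -> M -> M) : Prop :=
  [/\ forall h, H h -> forall x y, act h (x + y) = act h x + act h y,
      forall h, H h -> forall (c : rat) x, act h (c *: x) = c *: act h x,
      forall x, act tg_one x = x,
      forall g h, H g -> H h -> forall x, act (tg_mul g h) x = act g (act h x) &
      forall x, open_in H [set h | H h /\ act h x = x]].

Record dmod (G : tgroup) (H : set G) := DMod {
  dm_car :> lmodType rat;
  dm_act : G -> dm_car -> dm_car;
  dm_ax : dmod_axioms H dm_act }.

Arguments dm_act {G H} d : rename.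

Definition dhom (G : tgroup) (H : set G) (M N : dmod H) (f : M -> N) : Prop :=
  [/\ forall x y, f (x + y) = f x + f y,
      forall (c : rat) x, f (c *: x) = c *: f x &
      forall h, H h -> forall x, f (dm_act M h x) = dm_act N h (f x)].

Definition dprojective (G : tgroup) (H : set G) (P : dmod H) : Prop :=
  forall (M N : dmod H) (p : M -> N) (f : P -> N),
    dhom p -> dhom f -> (forall y, exists x, p x = y) ->
    exists g : P -> M, dhom g /\ forall x, p (g x) = f x.

Lemma triv_dmod_axioms (G : tgroup) (H : set G) :
  @dmod_axioms G H rat^o (fun _ x => x).
Proof.
split=> // x; exists setT; split; first exact: openT.
by rewrite setTI; apply/seteqP; split=> h /=; [case|].
Qed.

Definition triv_dmod (G : tgroup) (H : set G) : dmod H :=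
  DMod (triv_dmod_axioms H).

Definition has_proj_resolution (G : tgroup) (H : set G) (n : nat) : Prop :=
  exists (P : nat -> dmod H) (d : forall i, P i.+1 -> P i)
         (aug : P 0%N -> triv_dmod H),
  [/\ forall i, dprojective (P i),
      forall i, dhom (d i),
      dhom aug &
      [/\
      forall i, (n < i)%N -> forall x : P i, x = 0,
      forall y, exists x, aug x = y,
      forall x, aug x = 0 <-> exists y, d 0%N y = x &
      forall i (x : P i.+1), d i x = 0 <-> exists y, d i.+1 y = x]].

Definition cdQ_eq (G : tgroup) (H : set G) (k : nat) : Prop :=
  has_proj_resolution H k /\ forall m, (m < k)%N -> ~ has_proj_resolution H m.

Record hset (G : tgroup) (H : set G) := HSet {
  hs_car :> choiceType;
  hs_act : G -> hs_car -> hs_car }.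

Arguments hs_act {G H} h : rename.

Definition proper_fin_hset (G : tgroup) (H : set G) (O : hset H) : Prop :=
  [/\ forall w : O, hs_act O tg_one w = w,
      forall g h, H g -> H h -> forall w, hs_act O (tg_mul g h) w = hs_act O g (hs_act O h w),
      forall w, compact_open_in H [set h | H h /\ hs_act O h w = w] &
      exists s : seq O, forall w : O, exists2 w0, w0 \in s &
        exists h, H h /\ w = hs_act O h w0].

Definition QP (G : tgroup) (H : set G) (O : hset H) := {freeg O / rat}.

Definition QP_act (G : tgroup) (H : set G) (O : hset H) (h : G) (x : QP O) : QP O :=
  fglift (fun w : O => (<< hs_act O h w >> : {freeg O / rat})) x.

Definition norm1 (G : tgroup) (H : set G) (O : hset H) (x : QP O) : rat :=
  \sum_(w <- dom x) `|coeff w x|.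

Definition phom (G : tgroup) (H : set G) (O1 O2 : hset H) (f : QP O1 -> QP O2) : Prop :=
  [/\ forall x y, f (x + y) = f x + f y,
      forall (c : rat) x, f (c *: x) = c *: f x &
      forall h, H h -> forall x, f (QP_act h x) = QP_act h (f x)].

Definition aug_hom (G : tgroup) (H : set G) (O : hset H) (f : QP O -> rat) : Prop :=
  [/\ forall x y, f (x + y) = f x + f y,
      forall (c : rat) x, f (c *: x) = c * f x &
      forall h, H h -> forall x, f (QP_act h x) = f x].

(* kernel of delta_i, where delta_0 is the augmentation to Q *)
Definition dker (G : tgroup) (H : set G) (Om : nat -> hset H)
    (d : forall i, QP (Om i.+1) -> QP (Om i)) (e : QP (Om 0%N) -> rat) :
    forall i, QP (Om i) -> Prop :=
  fun i => match i as k return QP (Om k) -> Prop with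
           | 0%N => fun x => e x = 0
           | k.+1 => fun x => d k x = 0
           end.

Definition perm_resolution (G : tgroup) (H : set G) (m : nat) (Om : nat -> hset H)
    (d : forall i, QP (Om i.+1) -> QP (Om i)) (e : QP (Om 0%N) -> rat) : Prop :=
  [/\ forall i, (i <= m)%N -> proper_fin_hset (Om i),
      forall i, (i < m)%N -> phom (d i),
      aug_hom e,
      forall y, exists x, e x = y &
      forall i, (i < m)%N -> forall x : QP (Om i),
        dker d e x <-> exists y, d i y = x].

Definition type_FP (G : tgroup) (H : set G) (m : nat) : Prop :=
  exists Om d e, @perm_resolution G H m Om d e.

Definition type_FPinf (G : tgroup) (H : set G) : Prop :=
  forall m, type_FP H m.

(* weak n-dimensional linear isoperimetric inequality:
   inf { |y|_1 : delta_{n+1} y = x } <= C |x|_1 for x in ker delta_n,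
   written with the infimum unfolded (all norms are rational). *)
Definition weak_lin_isoperimetric (G : tgroup) (H : set G) (n : nat) : Prop :=
  exists Om d e, @perm_resolution G H n.+1 Om d e /\
    exists C : rat, 0 < C /\
      forall x : QP (Om n), dker d e x ->
        forall eps : rat, 0 < eps ->
          exists y : QP (Om n.+1), d n y = x /\ norm1 y <= C * norm1 x + eps.

(* Main.v *)
Require Import Defs.
From HB Require Import structures.
From mathcomp Require Import all_boot all_order all_algebra.
From mathcomp Require Import boolp classical_sets topology.
From mathcomp Require Import freeg lra.

Set Implicit Arguments.
Unset Strict Implicit.
Unset Printing Implicit Defensive.

Import Order.TTheory GRing.Theory Num.Theory.
Local Open Scope classical_set_scope.
Local Open Scope ring_scope.

(** Let [Q[Om]] be the given resolution for [G] and [Q[La]] one for [H]. Proper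
permutation modules are projective, by averaging over compact stabilizers, also
after restriction to [H]. Comparing [Q[Om]] with a projective resolution of
length [n+1] shows that [d_(n+1)] splits [G]-equivariantly onto the [n]-cycles,
and by the isoperimetric inequality the splitting [sigma] is bounded.
Comparing [Q[La]] with [Q[Om]] over [H] gives chain maps [a], [b] and a homotopy
[h] from [b a] to the identity, so that [b (sigma (a x)) - h x] fills an
[n]-cycle [x] of [Q[La]]. Here [a] and [h] are bounded because [La] has finitely
many [H]-orbits. [b] need not be bounded, but the elements [sigma (a x)] are all
supported on finitely many [H]-orbits, and there [b] is bounded. *)

(** * Modules with an action, homomorphisms and the lifting property *)

Record premod (G : tgroup) := PreMod {
  pm_car :> lmodType rat;
  pm_act : G -> pm_car -> pm_car }.

Arguments pm_act {G} p : rename.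

Section Modules.
Variables (G : tgroup) (H : set G).
Implicit Types M N P : premod G.

(** The axioms are kept apart from [premod], so that one carrier with one action can be viewed over
    [G] and over a subgroup. *)
Definition discrete M : Prop := dmod_axioms H (pm_act M).

(* For [H = set0] this is mere linearity. *)
Definition is_hom M N (f : M -> N) : Prop :=
  [/\ forall x y, f (x + y) = f x + f y,
      forall (c : rat) x, f (c *: x) = c *: f x &
      forall h, H h -> forall x, f (pm_act M h x) = pm_act N h (f x)].

(** Projectivity relative to the range of [p]: with [p] a boundary map and [f] taking values in
    cycles, exactness supplies the premise and no kernel module has to be formed. *)
Definition lifting P : Prop :=
  forall M N (p : M -> N) (f : P -> N), discrete M -> discrete N ->
    is_hom p -> is_hom f -> (forall x, exists y, p y = f x) ->
    exists g : P -> M, is_hom g /\ forall x, p (g x) = f x.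

Lemma hom0 M N (f : M -> N) : is_hom f -> f 0 = 0.
Proof. by case=> _ /(_ 0 0) + _; rewrite !scale0r. Qed.

Lemma homN M N (f : M -> N) x : is_hom f -> f (- x) = - f x.
Proof. by case=> _ fZ _; rewrite -scaleN1r fZ scaleN1r. Qed.

Lemma homB M N (f : M -> N) x y : is_hom f -> f (x - y) = f x - f y.
Proof. by move=> hf; case: (hf) => fD _ _; rewrite fD homN. Qed.

Lemma hom_sum M N (f : M -> N) I (r : seq I) (F : I -> M) :
  is_hom f -> f (\sum_(i <- r) F i) = \sum_(i <- r) f (F i).
Proof.
move=> hf; apply: (big_morph f); last exact: hom0.
by case: hf.
Qed.

Lemma hom_id M : is_hom (@id M).
Proof. by split. Qed.

Lemma hom_comp M N P (f : M -> N) (g : N -> P) : is_hom f -> is_hom g -> is_hom (g \o f).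
Proof.
case=> fD fZ fh [gD gZ gh]; split=> [x y|c x|h Hh x] /=.
- by rewrite fD gD.
- by rewrite fZ gZ.
- by rewrite fh // gh.
Qed.

Lemma hom_sub M N (f g : M -> N) :
  discrete N -> is_hom f -> is_hom g -> is_hom (fun x => f x - g x).
Proof.
case=> aD aZ _ _ _ [fD fZ fh] [gD gZ gh]; split=> [x y|c x|h Hh x] /=.
- by rewrite fD gD opprD addrACA.
- by rewrite fZ gZ scalerBr.
- by rewrite fh // gh // aD // -(scaleN1r (g x)) aZ // scaleN1r.
Qed.

Lemma hom_cst0 M N : discrete N -> is_hom (fun _ : M => 0 : N).
Proof.
case=> _ aZ _ _ _; split=> [x y|c x|h Hh x]; rewrite ?addr0 ?scaler0 //.
by rewrite -(scale0r (0 : N)) aZ // !scale0r.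
Qed.

End Modules.

(** * Comparison of resolutions *)

Section Comparison.
Variables (G : tgroup) (H : set G).

(** Index [0] holds the resolved module. Everything there is a cycle, so exactness at [0] makes
    [d 0] onto. *)
Definition cycles (A : nat -> premod G) (d : forall k, A k.+1 -> A k) k :
    A k -> Prop :=
  match k with 0%N => fun=> True | j.+1 => fun x => d j x = 0 end.

Definition is_resolution (A : nat -> premod G) (d : forall k, A k.+1 -> A k) m :=
  [/\ forall k, (k <= m.+1)%N -> discrete H (A k),
      forall k, (k <= m)%N -> lifting H (A k.+1),
      forall k, (k <= m)%N -> is_hom H (d k) &
      forall k, (k <= m)%N -> forall x, cycles d x <-> exists y, d k y = x].

(** Induction on the degree, lifting chain maps and homotopy through exactness. The homotopy
    identity is kept only on cycles, where the term from the previous degree vanishes, so a single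
    [h] has to be carried along. *)
Lemma comparison (A B : nat -> premod G) (dA : forall k, A k.+1 -> A k)
    (dB : forall k, B k.+1 -> B k) m (a0 : A 0%N -> B 0%N) (b0 : B 0%N -> A 0%N) :
  is_resolution dA m -> is_resolution dB m ->
  is_hom H a0 -> is_hom H b0 -> cancel a0 b0 ->
  forall k, (k <= m)%N ->
  exists (a : A k -> B k) (a' : A k.+1 -> B k.+1)
         (b : B k -> A k) (b' : B k.+1 -> A k.+1) (h : A k -> A k.+1),
  [/\ [/\ is_hom H a, is_hom H a', is_hom H b, is_hom H b' & is_hom H h],
      forall x, dB k (a' x) = a (dA k x),
      forall x, dA k (b' x) = b (dB k x) &
      forall x, cycles dA x -> dA k (h x) = b (a x) - x].
Proof.
move=> [discA liftA homA exA] [discB liftB homB' exB] ha0 hb0 abK.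
elim=> [_|k IH km].
  have [a' [ha' Ea']] : exists a' : A 1%N -> B 1%N, is_hom H a' /\
      forall x, dB 0%N (a' x) = a0 (dA 0%N x).
    apply: (liftA 0%N) => //; [exact: discB|exact: discB|exact: homB'| |].
      by apply: hom_comp => //; apply: homA.
    by move=> x; apply/exB.
  have [b' [hb' Eb']] : exists b' : B 1%N -> A 1%N, is_hom H b' /\
      forall x, dA 0%N (b' x) = b0 (dB 0%N x).
    apply: (liftB 0%N) => //; [exact: discA|exact: discA|exact: homA| |].
      by apply: hom_comp => //; apply: homB'.
    by move=> x; apply/exA.
  (* In degree [0] the composite [b0 (a0 x)] is already [x], so the zero homotopy works. *)
  exists a0, a', b0, b', (fun=> 0); split=> //.
    by split=> //; apply: hom_cst0; apply: discA.
  by move=> x _; rewrite (hom0 (homA 0%N _)) // abK subrr.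
have km' := ltnW km.
have [a [a' [b [b' [h [[ha ha' hb hb' hh] Ea' Eb' Eh]]]]]] := IH km'.
have ddA x : dA k (dA k.+1 x) = 0.
  by apply/(exA k.+1 km); exists x.
have ddB x : dB k (dB k.+1 x) = 0.
  by apply/(exB k.+1 km); exists x.
have [a2 [ha2 Ea2]] : exists a2 : A k.+2 -> B k.+2, is_hom H a2 /\
    forall x, dB k.+1 (a2 x) = a' (dA k.+1 x).
  apply: liftA => //; [exact: discB|exact: discB|exact: homB'| |].
    by apply: hom_comp => //; apply: homA.
  by move=> x; apply/exB => //=; rewrite Ea' ddA (hom0 ha).
have [b2 [hb2 Eb2]] : exists b2 : B k.+2 -> A k.+2, is_hom H b2 /\
    forall x, dA k.+1 (b2 x) = b' (dB k.+1 x).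
  apply: liftB => //; [exact: discA|exact: discA|exact: homA| |].
    by apply: hom_comp => //; apply: homB'.
  by move=> x; apply/exA => //=; rewrite Eb' ddB (hom0 hb).
have [h' [hh' Eh']] : exists h' : A k.+1 -> A k.+2, is_hom H h' /\
    forall x, dA k.+1 (h' x) = b' (a' x) - x - h (dA k x).
  apply: liftA => //; [exact: discA|exact: discA|exact: homA| |].
    apply: hom_sub; first exact: discA.
      apply: hom_sub; [exact: discA| |exact: hom_id].
      exact: (hom_comp ha' hb').
    by apply: (hom_comp (homA k _) hh).
  (* The map to be lifted lands in cycles: [dA k] sends it to [b (a u) - u - dA k (h u)] with
     [u = dA k x], which is zero because [u] is a cycle. *)
  move=> x; apply/exA => //=; have hA := homA k km'.
  rewrite !(homB _ _ hA) Eb' Ea' Eh ?subrr //.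
  by apply/exA => //; exists x.
exists a', a2, b', b2, h'; split=> // x /= dx0.
by rewrite Eh' dx0 (hom0 hh) subr0.
Qed.

End Comparison.

(** * The image of a homomorphism as a discrete module *)

Section Image.
Variables (G : tgroup) (H : set G) (M N : premod G) (p : M -> N).
Hypothesis hp : is_hom H p.

(** The proof of [is_hom H p] is an argument so that the submodule instance can depend on it. *)
Definition image_pred of is_hom H p : {pred N} := [pred x | `[< exists y, p y = x >]].

Lemma image_submod : submod_closed (image_pred hp).
Proof.
split; first by apply/asboolP; exists 0; apply: hom0 hp.
move=> c u v /asboolP[x <-] /asboolP[y <-]; apply/asboolP; exists (c *: x + y).
by case: hp => pD pZ _; rewrite pD pZ.
Qed.

HB.instance Definition _ :=
  GRing.isSubmodClosed.Build rat N (image_pred hp) image_submod.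

Inductive image_of : predArgType := ImageOf u & u \in image_pred hp.
Definition image_val w : N := let: ImageOf u _ := w in u.
HB.instance Definition _ := [isSub of image_of for image_val].
HB.instance Definition _ := [Choice of image_of by <:].
HB.instance Definition _ := [SubChoice_isSubZmodule of image_of by <:].
HB.instance Definition _ := [SubZmodule_isSubLmodule of image_of by <:].

Lemma image_act_subproof h (w : image_of) :
  H h -> pm_act N h (val w) \in image_pred hp.
Proof.
move=> Hh; case: w => u /= /asboolP[x <-]; apply/asboolP.
by exists (pm_act M h x); case: hp => _ _ ->.
Qed.

(** The default [w] of [insubd] can only be reached for [h] outside [H], since elements of [H]
    preserve the image. *)
Definition image_act (h : G) (w : image_of) : image_of :=
  insubd w (pm_act N h (val w)).

Lemma val_image_act h w : H h -> val (image_act h w) = pm_act N h (val w).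
Proof. by move=> Hh; rewrite /image_act val_insubd image_act_subproof. Qed.

Definition image_premod : premod G := PreMod image_act.

Lemma image_discrete : closed_subgroup H -> discrete H N -> discrete H image_premod.
Proof.
move=> [_ H1 HM _] [aD aZ a1 aM aO]; split.
- by move=> h Hh x y; apply: val_inj; rewrite /= !val_image_act // aD.
- by move=> h Hh c x; apply: val_inj; rewrite /= !val_image_act // aZ.
- by move=> x; apply: val_inj; rewrite /= val_image_act // a1.
- move=> g h Hg Hh x; apply: val_inj; rewrite /= !val_image_act //; last exact: HM.
  exact: aM.
- move=> x; have [V [oV EV]] := aO (val x); exists V; split=> //; rewrite -EV.
  apply/seteqP; split=> h [Hh /= E]; split=> //.
    by rewrite -val_image_act // E.
  by apply: val_inj; rewrite val_image_act.
Qed.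
End Image.

Definition premod_of_dmod (G : tgroup) (H : set G) (M : dmod H) : premod G :=
  PreMod (dm_act M).

(** Corestricting [p] and [f] to the image of [p] makes [p] surjective, and ordinary projectivity
    applies. *)
Lemma dprojective_lifting (G : tgroup) (H : set G) (P : dmod H) :
  closed_subgroup H -> dprojective P -> lifting H (premod_of_dmod P).
Proof.
move=> clH projP M N p f dM dN hp hf sub.
have im x : f x \in image_pred hp by apply/asboolP; apply: sub.
have imp y : p y \in image_pred hp by apply/asboolP; exists y.
have dI := image_discrete hp clH dN.
have [pD pZ ph] := hp; have [fD fZ fh] := hf.
have := projP (DMod dM) (DMod dI) (fun y => ImageOf (imp y)) (fun x => ImageOf (im x)).
case.
- split=> [x y|c x|h Hh x]; apply: val_inj => /=; rewrite ?pD ?pZ ?ph //.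
  by rewrite (val_image_act (ImageOf (imp x)) Hh).
- split=> [x y|c x|h Hh x]; apply: val_inj => /=; rewrite ?fD ?fZ //.
  by rewrite (val_image_act (ImageOf (im x)) Hh) /= -fh.
- by move=> [u iu]; have /asboolP[y py] := iu; exists y; apply: val_inj.
by move=> g [hg E]; exists g; split=> // x; have /(congr1 val) := E x.
Qed.

(** * Open stabilizers, finite orbits and averaging *)

Section Actions.
Variables (G : tgroup) (H : set G) (T : Type) (act : G -> T -> T).
Hypothesis tdlc : TDLC G.
Hypothesis clH : closed_subgroup H.
Hypothesis act1 : forall x, act tg_one x = x.
Hypothesis actM :
  forall g h, H g -> H h -> forall x, act (tg_mul g h) x = act g (act h x).

Definition stab x : set G := [set h | H h /\ act h x = x].

Lemma act_invK g x : H g -> act (tg_inv g) (act g x) = x.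
Proof.
move=> Hg; case: tdlc => -[_ _ gV] _ _ _; case: clH => _ _ _ HV.
by rewrite -actM ?(gV g).1 //; apply: HV.
Qed.

Lemma act_invKV g x : H g -> act g (act (tg_inv g) x) = x.
Proof.
move=> Hg; case: tdlc => -[_ _ gV] _ _ _; case: clH => _ _ _ HV.
by rewrite -actM ?(gV g).2 //; apply: HV.
Qed.

Lemma lmul_continuous (g : G) : continuous (tg_mul g).
Proof.
case: tdlc => _ mulC _ _ x.
apply: (@continuous_comp _ _ _ (fun h : G => (g, h)) (fun p => tg_mul p.1 p.2)).
  by apply: cvg_pair => /=; [exact: cvg_cst|exact: cvg_id].
exact: mulC.
Qed.

Lemma open_lmul_preimage (g : G) (V : set G) :
  open V -> open [set h | V (tg_mul g h)].
Proof. by move=> oV; apply: open_comp => // x _; apply: lmul_continuous. Qed.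

Lemma fiber_open x u : open_in H (stab x) -> H u ->
  open_in H [set h | H h /\ act h x = act u x].
Proof.
move=> [V [oV EV]] Hu; exists [set h | V (tg_mul (tg_inv u) h)].
split; first exact: open_lmul_preimage.
case: clH => _ _ HM HV.
apply/seteqP; split=> h /= [].
  move=> Hh E; split=> //.
  suff : (V `&` H) (tg_mul (tg_inv u) h) by case.
  rewrite -EV; split; first by apply: HM => //; apply: HV.
  by rewrite actM ?E ?act_invK //; apply: HV.
move=> Vh Hh; split=> //.
have : stab x (tg_mul (tg_inv u) h).
  by rewrite EV; split=> //; apply: HM => //; apply: HV.
move=> [_]; rewrite actM //; last exact: HV.
by move=> {2}<-; rewrite act_invKV.
Qed.

(** A subgroup containing a neighbourhood of the identity is open, being a union of translates of
    it. *)
Lemma stab_open x (V : set G) :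
  open V -> V tg_one -> (forall h, H h -> V h -> act h x = x) ->
  open_in H (stab x).
Proof.
move=> oV V1 Vx; case: clH => _ H1 HM HV; case: tdlc => -[mA g1 gV] _ _ _.
exists (\bigcup_(s in stab x) [set h | V (tg_mul (tg_inv s) h)]); split.
  by apply: bigcup_open => s _; apply: open_lmul_preimage.
apply/seteqP; split=> [h [Hh hx]|h [[s [Hs sx] /= Vs] Hh]].
  by split=> //; exists h => //=; rewrite (gV h).1.
split=> //.
have := Vx _ (HM _ _ (HV _ Hs) Hh) Vs.
rewrite actM //; last exact: HV.
by move=> E; rewrite -(act_invKV (act h x) Hs) E.
Qed.

Lemma stab_act_eq x g h : H g -> H h -> act g x = act h x ->
  stab x (tg_mul (tg_inv g) h).
Proof.
move=> Hg Hh E; case: clH => _ _ HM HV; split; first by apply: HM => //; apply: HV.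
by rewrite actM //; [rewrite -E act_invK|apply: HV].
Qed.

Lemma stab_sub x : stab x `<=` H. Proof. by move=> h []. Qed.

End Actions.

Section FiniteOrbit.
Variables (G : tgroup) (H : set G) (T : choiceType) (act : G -> T -> T).
Hypothesis tdlc : TDLC G.
Hypothesis clH : closed_subgroup H.
Hypothesis act1 : forall x, act tg_one x = x.
Hypothesis actM :
  forall g h, H g -> H h -> forall x, act (tg_mul g h) x = act g (act h x).

(** The orbit map of [x] is locally constant, so it takes finitely many values on a compact set. *)
Lemma finite_orbit x (K : set G) : K `<=` H -> compact K ->
  open_in H (stab H act x) ->
  exists s : seq T, uniq s /\ forall y, y \in s <-> exists2 u, K u & y = act u x.
Proof.
move=> KH cK oS.
(* The filter of sufficiently large finite lists turns the near-covering form of compactness into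
   the existence of one list containing all values. *)
pose F : set_system (seq T) :=
  [set A | exists s0 : seq T, forall s, {subset s0 <= s} -> A s].
have FF : Filter F.
  split.
  - by exists [::].
  - move=> A B [s As] [t Bt]; exists (s ++ t) => r sub; split.
      by apply: As => z zs; apply: sub; rewrite mem_cat zs.
    by apply: Bt => z zs; apply: sub; rewrite mem_cat zs orbT.
  - by move=> A B AB [s As]; exists s => r /As /AB.
have /compact_near_coveringP cov := cK.
have := cov _ F (fun s u => K u -> act u x \in s) FF.
case.
  move=> u Ku; have [V [oV EV]] := fiber_open tdlc clH act1 actM oS (KH _ Ku).
  exists (V, [set s : seq T | act u x \in s]) => /=.
    split; last by exists [:: act u x] => s; apply; rewrite mem_head.
    apply: open_nbhs_nbhs; split=> //.
    suff : (V `&` H) u by case.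
    by rewrite -EV; split=> //; apply: KH.
  move=> [v s] /= [Vv us] Kv.
  suff [_ ->] : [set h | H h /\ act h x = act u x] v by [].
  by rewrite EV; split=> //; apply: KH.
move=> s /(_ s (fun _ => id)) sub.
exists (undup [seq y <- s | `[< exists2 u, K u & y = act u x >]]).
split; first exact: undup_uniq.
move=> y; rewrite mem_undup mem_filter; split; first by case/andP => /asboolP.
move=> [u Ku ->]; apply/andP; split; last exact: sub.
by apply/asboolP; exists u.
Qed.

End FiniteOrbit.

(** Averaging: [z] is the mean of the finite orbit of [y] under [K]. [K] permutes this orbit and [p]
    is constant on it. *)
Lemma invariant_lift (G : tgroup) (H K : set G) (M N : premod G) (p : M -> N) y :
  TDLC G -> closed_subgroup H -> discrete H M -> discrete H N -> is_hom H p ->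
  K `<=` H -> compact K -> K tg_one ->
  (forall g h, K g -> K h -> K (tg_mul g h)) ->
  (forall h, K h -> pm_act N h (p y) = p y) ->
  exists z, p z = p y /\ forall h, K h -> pm_act M h z = z.
Proof.
move=> tdlc clH [aD aZ a1 aM aO] [bD bZ b1 bM bO] hp KH cK K1 KM fix_y.
have [s [us sP]] := finite_orbit tdlc clH a1 aM KH cK (aO y).
have s0 : (size s)%:R != 0 :> rat.
  rewrite pnatr_eq0 size_eq0; apply/eqP => s0.
  by have /sP : exists2 u, K u & y = pm_act M u y; [exists tg_one|rewrite s0].
exists ((size s)%:R^-1 *: \sum_(x <- s) x); split.
  case: (hp) => pD pZ ph.
  rewrite pZ (hom_sum _ _ hp).
  rewrite (eq_big_seq (fun=> p y)); last first.
    by move=> x /sP[u Ku ->]; rewrite ph ?fix_y //; apply: KH.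
  by rewrite big_const_seq count_predT iter_addr_0 -scaler_nat scalerA mulVf // scale1r.
move=> h Kh; have Hh := KH _ Kh; rewrite aZ //; congr (_ *: _).
have ha : is_hom (set0 : set G) (pm_act M h) by split=> // *; [apply: aD|apply: aZ].
rewrite (hom_sum _ _ ha) -(big_map (pm_act M h) xpredT id).
have inj : injective (pm_act M h).
  by move=> a b E; rewrite -(act_invK tdlc clH a1 aM a Hh) E (act_invK tdlc clH a1 aM).
have uhs : uniq [seq pm_act M h i | i <- s] by rewrite map_inj_uniq.
(* An injective map of a finite orbit into itself permutes it. *)
have sub : {subset [seq pm_act M h i | i <- s] <= s}.
  move=> _ /mapP[x /sP[u Ku ->] ->]; apply/sP; exists (tg_mul h u); first exact: KM.
  by rewrite aM //; apply: KH.
apply: perm_big; apply: uniq_perm => //.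
by have [|_ E] := uniq_min_size uhs sub; rewrite ?size_map.
Qed.

(** * Free modules and the l1-norm *)

Section FreeModule.
Variables (K : choiceType).
Implicit Types x y : {freeg K / rat}.

Lemma freeg_eq_sum x : x = \sum_(w <- dom x) coeff w x *: << w >>.
Proof.
rewrite -{1}(freeg_sumE x); apply: eq_bigr => w _.
by apply/eqP/freeg_eqP => v; rewrite coeffZ !coeffU mul1r.
Qed.

Lemma fgliftD (V : lmodType rat) (f : K -> V) x y :
  fglift f (x + y) = fglift f x + fglift f y.
Proof.
have fB := lift_is_additive f.
have fN z : fglift f (- z) = - fglift f z.
  by rewrite -[- z]sub0r fB -{1}(subrr z) fB subrr sub0r.
by rewrite -[y in LHS]opprK fB fN opprK.
Qed.

Lemma fgliftZ (V : lmodType rat) (f : K -> V) c x :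
  fglift f (c *: x) = c *: fglift f x.
Proof.
have f0 : fglift f 0 = 0 by rewrite -(subrr 0) lift_is_additive subrr.
have fS I (r : seq I) (F : I -> {freeg K / rat}) :
    fglift f (\sum_(i <- r) F i) = \sum_(i <- r) fglift f (F i).
  exact: (big_morph _ (fgliftD f) f0).
have cU k w : c *: << k *g w >> = << (c * k) *g w >> :> {freeg K / rat}.
  by apply/eqP/freeg_eqP => v; rewrite coeffZ !coeffU mulrA.
rewrite -(freeg_sumE x) scaler_sumr !fS scaler_sumr; apply: eq_bigr => w _.
by rewrite cU !liftU scalerA.
Qed.

Lemma fglift1 (V : lmodType rat) (f : K -> V) w : fglift f << w >> = f w.
Proof. by rewrite liftU scale1r. Qed.

End FreeModule.

Section Norm.
Variables (G : tgroup) (H : set G).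
Implicit Types O : hset H.

(** Padding with zero coefficients lets the norms of several elements be compared over one list. *)
Lemma norm1E O (x : QP O) (s : seq O) : uniq s -> {subset dom x <= s} ->
  norm1 x = \sum_(w <- s) `|coeff w x|.
Proof.
move=> us sub; rewrite /norm1 [RHS](bigID (mem (dom x))) /= [X in _ = _ + X]big1 ?addr0.
  rewrite -[RHS]big_filter; apply: perm_big; apply: uniq_perm; rewrite ?filter_uniq ?uniq_dom //.
  move=> w; rewrite mem_filter; by case: (boolP (w \in dom x)) => //= /sub ->.
by move=> w /coeff_outdom ->; rewrite normr0.
Qed.

Lemma norm1_ge0 O (x : QP O) : 0 <= norm1 x.
Proof. by apply: sumr_ge0. Qed.

Lemma norm1_0 O : norm1 (0 : QP O) = 0.
Proof. by rewrite /norm1 dom0 big_nil. Qed.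

Lemma norm1D O (x y : QP O) : norm1 (x + y) <= norm1 x + norm1 y.
Proof.
pose s := undup (dom x ++ dom y).
have us : uniq s by exact: undup_uniq.
rewrite !(@norm1E _ _ s) //.
- by rewrite -big_split /=; apply: ler_sum => w _; rewrite coeffD ler_normD.
- by move=> w; rewrite mem_undup mem_cat orbC => ->.
- by move=> w; rewrite mem_undup mem_cat => ->.
- by move=> w /domD_subset; rewrite mem_undup.
Qed.

Lemma norm1Z O c (x : QP O) : norm1 (c *: x) = `|c| * norm1 x.
Proof.
rewrite (@norm1E _ _ (dom x)) ?uniq_dom //; last exact: domZ_subset.
by rewrite mulr_sumr; apply: eq_bigr => w _; rewrite coeffZ normrM.
Qed.

Lemma norm1B O (x y : QP O) : norm1 (x - y) <= norm1 x + norm1 y.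
Proof. by rewrite (le_trans (norm1D _ _)) // -scaleN1r norm1Z normrN1 mul1r. Qed.

Lemma norm1U O (w : O) : norm1 (<< w >> : QP O) = 1.
Proof. by rewrite /norm1 domU1 big_seq1 coeffU eqxx mulr1 normr1. Qed.

Lemma norm1_sum O I (r : seq I) (F : I -> QP O) :
  norm1 (\sum_(i <- r) F i) <= \sum_(i <- r) norm1 (F i).
Proof.
elim/big_ind2: _ => //; first by rewrite norm1_0.
by move=> x a y b xa yb; rewrite (le_trans (norm1D _ _)) // lerD.
Qed.

Definition perm_premod O : premod G :=
  @PreMod G {freeg O / rat} (@QP_act G H O).

End Norm.

(** * Bounded homomorphisms and supports on finitely many orbits *)

Section Bounds.
Variables (G : tgroup) (H : set G).

Lemma fglift_linear (O : hset H) (M : premod G) (f : O -> M) :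
  is_hom set0 (fglift f : perm_premod O -> M).
Proof. by split=> // [x y|c x]; [exact: fgliftD|exact: fgliftZ]. Qed.

Lemma QP_act_linear (O : hset H) h :
  is_hom set0 (@QP_act G H O h : perm_premod O -> perm_premod O).
Proof. exact: fglift_linear. Qed.

(** Triangle inequality over the basis expansion of [x]. A separate [H'] covers both equivariant
    maps and the action of one element, which is only linear. *)
Lemma norm1_le (H' : set G) (O1 O2 : hset H)
    (f : perm_premod O1 -> perm_premod O2) (C : rat) (x : QP O1) :
  is_hom H' f ->
  (forall w, w \in dom x -> norm1 (f << w >> : QP O2) <= C) ->
  norm1 (f x : QP O2) <= C * norm1 x.
Proof.
move=> hf fC; rewrite {1}(freeg_eq_sum x) (hom_sum _ _ hf).
apply: le_trans (norm1_sum _ _) _; rewrite /norm1 mulr_sumr.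
rewrite !big_seq; apply: ler_sum => w wx.
case: hf => _ fZ _; rewrite fZ -/(norm1 _) norm1Z mulrC.
by apply: ler_wpM2r => //; apply: fC.
Qed.

Lemma QP_actU (O : hset H) h w : QP_act h (<< w >> : QP O) = << hs_act O h w >>.
Proof. exact: fglift1. Qed.

Lemma norm1_act (O : hset H) h (x : QP O) : norm1 (QP_act h x) <= norm1 x.
Proof.
have hact := QP_act_linear O h.
rewrite -[leRHS]mul1r; apply: (norm1_le hact) => w _.
by rewrite QP_actU norm1U.
Qed.

Lemma dom_act (O : hset H) h (x : QP O) w :
  w \in dom (QP_act h x) -> exists2 v, v \in dom x & w = hs_act O h v.
Proof.
have hact := QP_act_linear O h.
rewrite {1}(freeg_eq_sum x) (hom_sum _ _ hact) => /dom_sum_subset.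
move=> /flatten_mapP[v]; rewrite mem_filter => /andP[_ vx].
case: hact => _ actZ _; rewrite actZ => /domZ_subset.
by rewrite QP_actU domU1 inE => /eqP ->; exists v.
Qed.

(** The action does not increase the norm, so [f] on a basis element is controlled by its value at
    the representative in [s]; the sum over [s] dominates all of these. [O1] itself may have
    infinitely many orbits. *)
Lemma bounded_on_orbits (O1 O2 : hset H) (f : perm_premod O1 -> perm_premod O2)
    (s : seq O1) : is_hom H f ->
  exists C : rat, 0 <= C /\ forall x : QP O1,
    (forall w, w \in dom x -> exists2 v, v \in s & exists h, H h /\ w = hs_act O1 h v) ->
    norm1 (f x : QP O2) <= C * norm1 x.
Proof.
move=> hf; exists (\sum_(v <- s) norm1 (f << v >> : QP O2)); split.
  by apply: sumr_ge0 => v _; apply: norm1_ge0.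
move=> x sx; apply: (norm1_le hf) => w /sx[v vs [h [Hh ->]]].
case: (hf) => _ _ fh; rewrite -QP_actU fh //.
apply: le_trans (norm1_act _ _) _.
rewrite (big_rem v) //= lerDl; apply: sumr_ge0 => u _; exact: norm1_ge0.
Qed.

Lemma bounded_hom (O1 O2 : hset H) (f : perm_premod O1 -> perm_premod O2) :
  proper_fin_hset O1 -> is_hom H f ->
  exists C : rat, 0 <= C /\ forall x : QP O1, norm1 (f x : QP O2) <= C * norm1 x.
Proof.
case=> _ _ _ [s sP] hf; have [C [C0 fC]] := bounded_on_orbits s hf.
by exists C; split=> // x; apply: fC => w _; apply: sP.
Qed.

(** By equivariance, every support is made of translates of the finite supports of [f] at the orbit
    representatives. *)
Lemma dom_hom_orbits (O1 O2 : hset H) (f : perm_premod O1 -> perm_premod O2) :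
  proper_fin_hset O1 -> is_hom H f ->
  exists s : seq O2, forall (x : QP O1) w, w \in dom (f x : QP O2) ->
    exists2 v, v \in s & exists h, H h /\ w = hs_act O2 h v.
Proof.
case=> _ _ _ [s sP] hf.
exists (flatten [seq dom (f << u >> : QP O2) | u <- s]) => x w.
rewrite {1}(freeg_eq_sum x) (hom_sum _ _ hf) => /dom_sum_subset.
move=> /flatten_mapP[v _]; case: (hf) => _ fZ fh; rewrite fZ => /domZ_subset.
have [u us [h [Hh ->]]] := sP v; rewrite -QP_actU fh // => /dom_act[t tu ->].
exists t; last by exists h.
by apply/flatten_mapP; exists u.
Qed.

End Bounds.

(** * Proper permutation modules are discrete and projective *)

Section ProperPermutation.
Variables (G : tgroup) (H : set G) (O : hset H).
Hypothesis tdlc : TDLC G.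
Hypothesis clH : closed_subgroup H.

(** Finiteness of the orbit set is left out because restriction from [G] to [H] can destroy it. *)
Definition proper_hset : Prop :=
  [/\ forall w : O, hs_act O tg_one w = w,
      forall g h, H g -> H h -> forall w, hs_act O (tg_mul g h) w = hs_act O g (hs_act O h w) &
      forall w, compact_open_in H (stab H (hs_act O) w)].

Hypothesis properO : proper_hset.

(** The stabilizer of [x] contains the intersection of the open stabilizers of the finitely many
    points in its support. *)
Lemma perm_discrete : discrete H (perm_premod O).
Proof.
have [a1 aM aS] := properO.
have hext (f g : perm_premod O -> perm_premod O) : is_hom set0 f -> is_hom set0 g ->
    (forall w, f << w >> = g << w >>) -> f =1 g.
  move=> hf hg fg x; rewrite (freeg_eq_sum x) (hom_sum _ _ hf) (hom_sum _ _ hg).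
  apply: eq_bigr => w _; case: hf => _ fZ _; case: hg => _ gZ _.
  by rewrite fZ gZ fg.
have hact := QP_act_linear O.
have b1 x : pm_act (perm_premod O) tg_one x = x.
  by apply: (hext _ id (hact _)) => // w; rewrite /= QP_actU a1.
have bM g h : H g -> H h -> forall x : perm_premod O,
    pm_act (perm_premod O) (tg_mul g h) x = pm_act _ g (pm_act _ h x).
  move=> Hg Hh; apply: (hext _ (fun x => QP_act g (QP_act h x)) (hact _)).
    exact: (hom_comp (hact h) (hact g)).
  by move=> w; rewrite !QP_actU aM.
split=> //.
- by move=> h _; case: (hact h).
- by move=> h _; case: (hact h).
move=> x.
have [V [oV V1 Vx]] : exists V : set G, [/\ open V, V tg_one &
    forall h, H h -> V h -> forall w, w \in dom x -> hs_act O h w = w].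
  elim: (dom x) => [|w s [V [oV V1 Vs]]].
    by exists setT; split=> //; exact: openT.
  have [_ _ [W [oW EW]]] := aS w.
  have WH h : H h -> W h <-> hs_act O h w = w.
    move=> Hh; have : stab H (hs_act O) w h <-> (W `&` H) h by rewrite EW.
    by move=> [E1 E2]; split=> [Wh|Eh]; [case: E2|case: E1].
  case: clH => _ H1 _ _.
  exists (V `&` W); split; first exact: openI.
    by split=> //; apply/WH.
  move=> h Hh [Vh Wh] v; rewrite inE => /orP[/eqP ->|]; last exact: Vs.
  exact/WH.
apply: (stab_open tdlc clH b1 bM oV V1) => h Hh Vh.
change (QP_act h (x : QP O) = x).
rewrite {1}(freeg_eq_sum x) (hom_sum _ _ (hact h)) [RHS](freeg_eq_sum x).
rewrite !big_seq; apply: eq_bigr => w wx; case: (hact h) => _ -> _.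
by rewrite QP_actU Vx.
Qed.

(* A lift of the image of [w] is made invariant under the compact stabilizer of
   [w] by averaging over its finite orbit, and then transported along the orbit
   of [w]. *)
Lemma perm_lifting : lifting H (perm_premod O).
Proof.
move=> M N p f dM dN hp hf sub.
have [a1 aM aS] := properO.
have [_ H1 HM HV] := clH.
have [pD pZ ph] := hp; have [fD fZ fh] := hf.
have [mD mZ m1 mM _] := dM.
pose orb w v := `[< exists h, H h /\ v = hs_act O h w >].
have orbP w v : reflect (exists h, H h /\ v = hs_act O h w) (orb w v) by exact: asboolP.
have orb_refl w : orb w w by apply/orbP; exists tg_one; rewrite a1.
have orbA h w : H h -> orb (hs_act O h w) =1 orb w.
  move=> Hh v; apply/orbP/orbP => -[g [Hg ->]].
    by exists (tg_mul g h); rewrite aM //; split=> //; apply: HM.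
  exists (tg_mul g (tg_inv h)); split; first by apply: HM => //; apply: HV.
  by rewrite aM ?(act_invK tdlc clH a1 aM) //; apply: HV.
(* [choose] gives the same answer at all points of an orbit, so [r] is an orbit representative. *)
pose r w := choose (orb w) w.
have orb_r w : orb w (r w) by exact: chooseP.
have rA h w : H h -> r (hs_act O h w) = r w.
  move=> Hh; rewrite /r (eq_choose (orbA h w Hh)); apply: choose_id => //.
  by apply/orbP; exists h.
have [z zP] : {z : O -> M & forall w, p (z w) = f << w >> /\
    forall h, stab H (hs_act O) w h -> pm_act M h (z w) = z w}.
  apply: (@choice _ _ (fun w z => p z = f << w >> /\
    forall h, stab H (hs_act O) w h -> pm_act M h z = z)) => w.
  have [y Ey] := sub << w >>.
  have [_ cS _] := aS w.
  have [|g h [Hg gw] [Hh hw]|h [Hh hw]|z [Ez Sz]] :=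
    invariant_lift tdlc clH dM dN hp (@stab_sub _ H _ (hs_act O) w) cS (y := y).
  - by split=> //; rewrite a1.
  - by split; [exact: HM|rewrite aM // hw].
  - by rewrite Ey -fh //= QP_actU hw.
  by exists z; rewrite Ez.
have [t tP] : {t : O -> G & forall w, H (t w) /\ w = hs_act O (t w) (r w)}.
  apply: (@choice _ _ (fun w t => H t /\ w = hs_act O t (r w))) => w.
  have /orbP[h [Hh ->]] := orb_r w; exists (tg_inv h); split; first exact: HV.
  by rewrite (act_invK tdlc clH a1 aM).
pose g0 w := pm_act M (t w) (z (r w)).
have g0A h w : H h -> g0 (hs_act O h w) = pm_act M h (g0 w).
  move=> Hh; rewrite /g0 rA //.
  have [Ht Ew] := tP w; have [Ht' Ew'] := tP (hs_act O h w).
  rewrite rA // {1}Ew -aM // in Ew'.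
  have Hht : H (tg_mul h (t w)) by apply: HM.
  (* The two transporters [t (hs_act O h w)] and [tg_mul h (t w)] differ by an element stabilizing
     [r w], which fixes [z (r w)]. *)
  have := (zP (r w)).2 _ (stab_act_eq tdlc clH a1 aM Ht' Hht (esym Ew')).
  rewrite mM //; last exact: HV.
  move/(congr1 (pm_act M (t (hs_act O h w)))).
  by rewrite (act_invKV tdlc clH m1 mM) // mM.
have hg : is_hom H (fglift g0 : perm_premod O -> M).
  split=> [x y|c x|h Hh x]; [exact: fgliftD|exact: fgliftZ|].
  have hg' : is_hom set0 (fglift g0 : perm_premod O -> M) := fglift_linear g0.
  have hact := QP_act_linear O h.
  have hm : is_hom set0 (pm_act M h) by split=> // *; [exact: mD|exact: mZ].
  change (fglift g0 (QP_act h (x : QP O)) = pm_act M h (fglift g0 x)).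
  rewrite (freeg_eq_sum x) (hom_sum _ _ hact) !(hom_sum _ _ hg') (hom_sum _ _ hm).
  apply: eq_bigr => w _; case: (hact) => _ -> _; rewrite !fgliftZ mZ //.
  by rewrite QP_actU !fglift1 g0A.
exists (fglift g0); split=> // x.
rewrite (freeg_eq_sum x) (hom_sum _ _ hg) (hom_sum _ _ hp) (hom_sum _ _ hf).
apply: eq_bigr => w _; rewrite fgliftZ pZ fZ fglift1 /g0.
have [Ht Ew] := tP w.
by rewrite ph // (zP _).1 -fh //= QP_actU -Ew.
Qed.

End ProperPermutation.

(** * Augmented resolutions and restriction to a closed subgroup *)

Definition triv_premod (G : tgroup) : premod G :=
  @PreMod G rat^o (fun _ x => x).

Lemma triv_discrete (G : tgroup) (H : set G) : discrete H (triv_premod G).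
Proof. exact: triv_dmod_axioms. Qed.

Section Augmented.
Variables (G : tgroup) (A : nat -> premod G) (d : forall i, A i.+1 -> A i).
Variable e : A 0%N -> triv_premod G.

(** The shift by one puts the trivial module at index [0]; index [n.+1] then means degree [n]. *)
Definition aug_mod (k : nat) : premod G :=
  if k is j.+1 then A j else triv_premod G.

Definition aug_d (k : nat) : aug_mod k.+1 -> aug_mod k :=
  match k return aug_mod k.+1 -> aug_mod k with 0%N => e | j.+1 => @d j end.

End Augmented.

Section Restriction.
Variables (G : tgroup) (H1 H : set G).
Hypothesis tdlc : TDLC G.
Hypothesis clH : closed_subgroup H.
Hypothesis subH : H `<=` H1.

Definition res_hset (O : hset H1) : hset H := @HSet G H O (hs_act O).

(** Stabilizers in [H] are compact as intersections of compact stabilizers with the closed set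
    [H]. *)
Lemma res_proper (O : hset H1) : proper_fin_hset O -> proper_hset (res_hset O).
Proof.
case=> a1 aM aS _; split=> // [g h Hg Hh w|w]; first exact: aM (subH Hg) (subH Hh) w.
have [_ cS [V [oV EV]]] := aS w.
have E : stab H (hs_act (res_hset O)) w = [set h | H1 h /\ hs_act O h w = w] `&` H.
  apply/seteqP; split=> [h [Hh hw]|h [[_ hw] Hh]]; split=> //.
  by split=> //; apply: subH.
split; first exact: stab_sub.
  by rewrite E; apply: compact_closedI => //; case: clH.
exists V; split=> //; rewrite E EV -setIA; congr (_ `&` _).
by apply/seteqP; split=> [h []|h Hh] //; split=> //; apply: subH.
Qed.

Lemma res_hom (M N : premod G) (f : M -> N) : is_hom H1 f -> is_hom H f.
Proof. by case=> fD fZ fh; split=> // h /subH; apply: fh. Qed.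

(** With [H1] possibly larger than [H], this serves both a resolution over [H] and the restriction
    of one over [G]. *)
Lemma perm_is_resolution m (Om : nat -> hset H1)
    (d : forall i, QP (Om i.+1) -> QP (Om i)) (e : QP (Om 0%N) -> rat) :
  perm_resolution m d e ->
  is_resolution H (@aug_d G (fun i => perm_premod (Om i)) d e) m.
Proof.
case=> prop hd [eD eZ eh] esurj ex; split=> [[|k] km|k km|[|k] km|[|k] km x].
- exact: triv_discrete.
- exact: (perm_discrete tdlc clH (res_proper (prop k km))).
- exact: (perm_lifting tdlc clH (res_proper (prop k km))).
- by apply: res_hom; split.
- exact: (@res_hom (perm_premod (Om k.+1)) (perm_premod (Om k)) _ (hd k km)).
- by split.
- by rewrite /= -(ex k km x); case: k km x.
Qed.

End Restriction.

(** * Finite projective dimension and the splitting of the top boundary *)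

Lemma dmod_is_resolution (G : tgroup) (H : set G) (P : nat -> dmod H)
    (d : forall i, P i.+1 -> P i) (aug : P 0%N -> triv_dmod H) m :
  closed_subgroup H -> (forall i, dprojective (P i)) -> (forall i, dhom (d i)) ->
  dhom aug -> (forall y, exists x, aug x = y) ->
  (forall x, aug x = 0 <-> exists y, d 0%N y = x) ->
  (forall i (x : P i.+1), d i x = 0 <-> exists y, d i.+1 y = x) ->
  is_resolution H (@aug_d G (fun i => premod_of_dmod (P i)) d aug) m.
Proof.
move=> clH projP hd haug augS ex0 ex; split=> [[|k] _|k _|[|k] _|[|[|k]] _ x].
- exact: triv_discrete.
- exact: dm_ax.
- exact: dprojective_lifting.
- exact: haug.
- exact: hd.
- by split.
- exact: ex0.
- exact: ex.
Qed.

(* The [n]-cycles form a projective module, hence [d n] splits onto them; [tau]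
   is [d n] followed by such a splitting. *)
Lemma top_splitting (G : tgroup) (H : set G) n (Om : nat -> hset H)
    (d : forall i, QP (Om i.+1) -> QP (Om i)) (e : QP (Om 0%N) -> rat) :
  TDLC G -> closed_subgroup H ->
  perm_resolution n.+1 d e -> has_proj_resolution H n.+1 ->
  exists tau : perm_premod (Om n.+1) -> perm_premod (Om n.+1),
  [/\ is_hom H tau, forall y, d n (tau y) = d n y &
      forall y, d n y = 0 -> tau y = 0].
Proof.
move=> tdlc clH res [P [dP [aug [projP hdP haug [P0 augS ex0 ex]]]]].
have resA := perm_is_resolution tdlc clH (@subset_refl _ H) res.
have resB := dmod_is_resolution n.+1 clH projP hdP haug augS ex0 ex.
have [a [a' [b [b' [h [[ha ha' hb hb' hh] Ea' Eb' Eh]]]]]] :=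
  comparison resA resB (hom_id H (triv_premod G)) (hom_id H (triv_premod G))
    (fun=> erefl) (leqnn n.+1).
have [discA _ homA exA] := resA.
have hd := homA _ (leqnn n.+1).
(* Applying [d n] gives [b (a u) - (b (a u) - u) = u] for [u = d n y]. *)
exists (fun y => b' (a' y) - h (d n y)); split.
- apply: hom_sub; first exact: (discA n.+2).
    exact: hom_comp ha' hb'.
  exact: (hom_comp hd hh).
- move=> y; have := homB (b' (a' y)) (h (d n y)) hd => /= ->.
  have /= -> := Eb' (a' y); have /= -> := Ea' y.
  have /= -> := Eh (d n y); first by rewrite opprB addrC subrK.
  by apply/(exA _ (leqnn n.+1)); exists y.
(* Here the length of the resolution enters: [a' y] is a cycle, hence a boundary from [P n.+2],
   which is zero. *)
- move=> y dy0; have /= := Ea' y; rewrite dy0 (hom0 ha) => /ex[z <-].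
  rewrite (P0 n.+2 _ z) // (hom0 hh) subr0.
  (* The boundary out of [P n.+2] lies one index beyond [resB]. *)
  have [_ _ homB' _] := dmod_is_resolution n.+2 clH projP hdP haug augS ex0 ex.
  have /= -> := hom0 (homB' n.+2 (leqnn _)).
  exact: hom0 hb'.
Qed.

(** * Transfer of linear fillings to the closed subgroup *)

Theorem theorem1p5 (G : tgroup) (n : nat) :
  TDLC G ->
  type_FPinf [set: G] ->
  cdQ_eq [set: G] n.+1 ->
  weak_lin_isoperimetric [set: G] n ->
  forall H : set G, closed_subgroup H ->
    type_FP H n.+1 -> weak_lin_isoperimetric H n.
Proof.
move=> tdlc _ [cdG _] [Om [dG [eG [resG [C [C0 isoG]]]]]] H clH [La [dH [eH resH]]].
have clG : closed_subgroup [set: G] by split=> //; exact: closedT.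
have [tau [htau dtau tau0]] := top_splitting tdlc clG resG cdG.
have subH : H `<=` [set: G] by [].
have resA := perm_is_resolution tdlc clH (@subset_refl _ H) resH.
have resB := perm_is_resolution tdlc clH subH resG.
have [a [a' [b [b' [h [[ha ha' hb hb' hh] Ea' Eb' Eh]]]]]] :=
  comparison resA resB (hom_id H (triv_premod G)) (hom_id H (triv_premod G))
    (fun=> erefl) (leqnn n.+1).
have [_ _ homA exA] := resA.
have [_ _ homG _] := resB.
have hd := homA _ (leqnn n.+1).
have [propG _ _ _ exG] := resG; have [propH _ _ _ exH] := resH.
(* [tau] is bounded over [G], where [Om n.+1] has finitely many orbits. *)
have [Ct [Ct0 bt]] := bounded_hom (propG n.+1 (leqnn _)) htau.
have [Ca [Ca0 ba]] :=
  @bounded_hom G H (La n) (res_hset H (Om n)) a (propH n (leqnSn n)) ha.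
have [Ch [Ch0 bh]] := @bounded_hom G H (La n) (La n.+1) h (propH n (leqnSn n)) hh.
have hta : is_hom H (tau \o a') by apply: hom_comp ha' (res_hom subH htau).
have [s sP] := @dom_hom_orbits G H (La n.+1) (res_hset H (Om n.+1)) (tau \o a')
  (propH n.+1 (leqnn _)) hta.
have [Cb [Cb0 bb]] :=
  @bounded_on_orbits G H (res_hset H (Om n.+1)) (La n.+1) b' s hb'.
exists La, dH, eH; split=> //.
(* The product bounds [b' (tau z)] up to the error, [Ch] bounds [h x], and [1] ensures
   positivity. *)
exists (Cb * Ct * C * Ca + Ch + 1); split.
  by rewrite ltr_wpDl // addr_ge0 // !mulr_ge0 // ltW.
move=> x x0 eps eps0.
have /(exH n (ltnSn n)) [y Ey] := x0.
have cx : dker dG eG (a x : QP (Om n)).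
  by apply/(exG n (ltnSn n)); exists (a' y); rewrite -Ey; apply: Ea'.
have D0 : 0 < Cb * Ct + 1 by rewrite ltr_wpDl // mulr_ge0.
(* The error is scaled so that it stays below [eps] after multiplication by [Cb * Ct]. *)
have [z [Ez nz]] := isoG _ cx _ (divr_gt0 eps0 D0).
(* Both [a' y] and [z] fill [a x], and [tau] depends only on the boundary. So [z] controls the norm
   of [tau z], and [a' y] its support. *)
have Etau : tau (a' y) = tau z.
  apply/eqP; rewrite -subr_eq0 -(homB _ _ htau); apply/eqP; apply: tau0.
  have /= -> := homB (a' y) z (homG _ (leqnn n.+1)).
  by rewrite Ez; have /= -> := Ea' y; rewrite Ey subrr.
(* Its boundary is [b (a x) - (b (a x) - x) = x]. *)
exists (b' (tau z) - h x); split.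
  have /= -> := homB (b' (tau z)) (h x) hd.
  have /= -> := Eb' (tau z); rewrite dtau Ez.
  have /= -> := Eh x; first by rewrite opprB addrC subrK.
  by apply/(exA _ (leqnn n.+1)); exists y.
have nt : norm1 (tau z : QP (Om n.+1)) <= Ct * (C * (Ca * norm1 x) + eps / (Cb * Ct + 1)).
  apply: le_trans (bt z) _; apply: ler_wpM2l => //; apply: le_trans nz _.
  by rewrite lerD2r; apply: ler_wpM2l; [exact: ltW|exact: ba].
have nb : norm1 (b' (tau z) : QP (La n.+1)) <= Cb * norm1 (tau z : QP (Om n.+1)).
  by apply: bb; rewrite -Etau; apply: sP.
apply: le_trans (norm1B _ _) _.
apply: le_trans (lerD (le_trans nb (ler_wpM2l Cb0 nt)) (bh x)) _.
have small : Cb * Ct * (eps / (Cb * Ct + 1)) <= eps.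
  rewrite mulrCA ler_piMr ?(ltW eps0) // ler_pdivrMr // mul1r lerDl.
  exact: ler01.
have := norm1_ge0 x; lra.
Qed.
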